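(* Let $\mathcal{C}$ be the class of digraphs whose shortest directed cycle (if it exists) has length that is an even power of two (i.e. of the form $2^{2j}$, $j\ge0$). Then $\mathcal{C}$ is not decided by an adaptive left $k$-query algorithm over $\mathbb{N}$ for any $k$.
   Context: Digraphs are finite structures $(V,R)$, $V\ne\varnothing$, $R\subseteq V\times V$; a directed cycle of length $\ell$ is a sequence of distinct vertices $a_0,\dots,a_{\ell-1}$ with $(a_i,a_{i+1})\in R$ for $i<\ell-1$ and $(a_{\ell-1},a_0)\in R$ (a loop is a directed cycle of length 1). $\mathsf{FIN}$ is the class of all digraphs; $\hom(F,A)$ is the number of homomorphisms $F\to A$. For a set $\Sigma$, $\Sigma^{<\omega}$ is the set of finite strings over $\Sigma$; a subtree is a prefix-closed subset, a leaf an element with no proper extension in it. An adaptive left query algorithm over $\mathbb{N}$ is a function $G:\mathcal{T}\to\mathsf{FIN}\cup\{\mathsf{YES},\mathsf{NO}\}$ with $\mathcal{T}\subseteq\mathbb{N}^{<\omega}$ a subtree and $G(\sigma)\in\{\mathsf{YES},\mathsf{NO}\}$ iff $\sigma$ is a leaf. Its computation path on input $A$ is the limit of $\sigma_0=\varepsilon$, $\sigma_{i+1}=\sigma_i$ if $G(\sigma_i)\in\{\mathsf{YES},\mathsf{NO}\}$, else $\sigma_{i+1}=\sigma_i\bullet\hom(G(\sigma_i),A)$. The algorithm is required to halt (finite path) on all inputs; it decides $\{A: G(\text{path of }A)=\mathsf{YES}\}$. It is an adaptive left $k$-query algorithm if every computation path has length at most $k$. *)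

(* Defs.v *)
From mathcomp Require Import all_boot.

Set Implicit Arguments.
Unset Strict Implicit.
Unset Printing Implicit Defensive.

Record digraph := Digraph {
  vertex :> finType;
  arc_rel : rel vertex;
  vertex_nonempty : 0 < #|vertex| }.

Definition is_hom (F A : digraph) (f : {ffun F -> A}) : bool :=
  [forall x, forall y, arc_rel x y ==> arc_rel (f x) (f y)].

Definition hom (F A : digraph) : nat := #|[set f : {ffun F -> A} | is_hom f]|.

(* [ucycle] holds of the empty sequence, hence the condition on [l]; for      *)
(* [c = [:: a]] it says that [a] carries a loop.                              *)
Definition has_dicycle (A : digraph) (l : nat) : Prop :=
  0 < l /\ exists c : seq A, size c = l /\ ucycle (@arc_rel A) c.

Definition shortest_dicycle_length (A : digraph) (l : nat) : Prop :=
  has_dicycle A l /\ forall l', has_dicycle A l' -> l <= l'.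

(* Acyclic digraphs belong to this class.                                     *)
Definition girth_even_power_of_two (A : digraph) : Prop :=
  forall l, shortest_dicycle_length A l -> exists j, l = 2 ^ (2 * j).

Inductive node := Query of digraph | YES | NO.

Definition is_answer (v : node) : Prop := v = YES \/ v = NO.

Definition subtree (T : seq nat -> Prop) : Prop :=
  forall s t, prefix s t -> T t -> T s.

Definition leaf (T : seq nat -> Prop) (s : seq nat) : Prop :=
  T s /\ forall t, T t -> prefix s t -> t = s.

Definition next_state (G : seq nat -> node) (A : digraph) (s : seq nat) :
    seq nat :=
  if G s is Query F then rcons s (hom F A) else s.

Definition state (G : seq nat -> node) (A : digraph) (i : nat) : seq nat :=
  iter i (next_state G A) [::].

(* The function on the subtree [alg_tree] is the restriction of [alg_fun];    *)
(* the values of [alg_fun] outside the subtree are never used, since          *)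
(* [alg_state] requires every computation to stay inside it.                  *)
Record left_query_algorithm := LeftQueryAlgorithm {
  alg_tree : seq nat -> Prop;
  alg_fun :> seq nat -> node;
  alg_subtree : subtree alg_tree;
  alg_answer : forall s, alg_tree s ->
    (is_answer (alg_fun s) <-> leaf alg_tree s);
  alg_state : forall A i, alg_tree (state alg_fun A i);
  alg_halts : forall A, exists i, is_answer (alg_fun (state alg_fun A i)) }.

(* The limit of the states, when it is a finite string.                       *)
Definition computation_path (G : left_query_algorithm) (A : digraph)
    (s : seq nat) : Prop :=
  exists n, forall i, n <= i -> state G A i = s.

Definition decides (G : left_query_algorithm) (C : digraph -> Prop) : Prop :=
  forall A, C A <-> exists s, computation_path G A s /\ G s = YES.

Definition k_query (k : nat) (G : left_query_algorithm) : Prop :=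
  forall A s, computation_path G A s -> size s <= k.

(* Main.v *)
(** For fixed [L], let [D g] be the digraph on Z/2^L with arcs x -> x + 2^(L-g):
    it is a disjoint union of directed cycles of length 2^g. The homomorphisms
    from [F] to [D g], if there are any, form a coset of the group of maps that
    are constant along the arcs of [F], and this group does not depend on [g].
    Hence hom(F, D g) is either 0 or a constant depending on [F] only, and by
    doubling maps it is nonzero on an initial segment of the [g]'s. Each query
    thus performs at best one step of a binary search for [g], and when
    L = 2^k some two consecutive [D g] are not separated by [k] queries. *)

Require Import Defs.
From mathcomp Require Import all_boot.
From mathcomp Require Import ssralg finalg zmodp zify.

Set Implicit Arguments.
Unset Strict Implicit.
Unset Printing Implicit Defensive.

Import GRing.Theory.

Lemma finZmod_nonempty (V : finZmodType) : 0 < #|V|.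
Proof. by apply/card_gt0P; exists 0%R. Qed.

Definition translation_digraph (V : finZmodType) (d : V) : digraph :=
  @Digraph V (frel (fun x => x + d)%R) (finZmod_nonempty V).

Section TranslationHom.

Variables (V : finZmodType) (F : digraph).

Lemma is_hom_translationP (d : V) (f : {ffun F -> V}) :
  reflect (forall x y, arc_rel x y -> f y = f x + d)%R
          (@is_hom F (translation_digraph d) f).
Proof.
apply: (iffP forallP) => [H x y xy | H x].
  by move/forallP/(_ y): (H x); rewrite xy => /eqP.
by apply/forallP => y; apply/implyP => /H /= ->.
Qed.

Lemma hom_translation_gt0P (d : V) :
  reflect (exists f : {ffun F -> V}, @is_hom F (translation_digraph d) f)
          (0 < hom F (translation_digraph d)).
Proof.
by apply: (iffP card_gt0P) => -[f]; rewrite ?inE => Hf; exists f; rewrite ?inE.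
Qed.

(** Adding a fixed homomorphism [f0] maps the homomorphisms for translation by 0, which are the maps
    constant along the arcs of [F], bijectively onto those for [d]. *)
Lemma hom_translation (d : V) :
  0 < hom F (translation_digraph d) ->
  hom F (translation_digraph d) = hom F (translation_digraph (0 : V)%R).
Proof.
case/hom_translation_gt0P => f0 /is_hom_translationP Hf0.
pose shift (f : {ffun F -> V}) : {ffun F -> V} := [ffun x => f x + f0 x]%R.
have shift_inj : injective shift.
  move=> f1 f2 /ffunP eqf; apply/ffunP => x.
  by have := eqf x; rewrite !ffunE => /addIr.
rewrite [RHS]/hom -(card_imset _ shift_inj) /hom; apply: eq_card => f.
rewrite inE; apply/is_hom_translationP/imsetP => [Hf | [f1]].
  exists [ffun x => f x - f0 x]%R; last first.
    by apply/ffunP => x; rewrite !ffunE subrK.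
  rewrite inE; apply/is_hom_translationP => x y xy; rewrite !ffunE.
  by rewrite (Hf _ _ xy) (Hf0 _ _ xy) opprD addrACA subrr.
rewrite inE => /is_hom_translationP Hf1 -> x y xy; rewrite !ffunE.
by rewrite (Hf1 _ _ xy) (Hf0 _ _ xy) addr0 addrA.
Qed.

Lemma hom_translation_mulrn (d : V) (n : nat) :
  0 < hom F (translation_digraph d) ->
  0 < hom F (translation_digraph (d *+ n)%R).
Proof.
case/hom_translation_gt0P => f /is_hom_translationP Hf.
apply/hom_translation_gt0P; exists [ffun x => f x *+ n]%R.
apply/is_hom_translationP => x y xy; rewrite !ffunE.
by rewrite (Hf _ _ xy) mulrnDl.
Qed.

End TranslationHom.

Definition cycles_digraph (L g : nat) : digraph :=
  translation_digraph ((2 ^ (L - g))%:R : 'Z_(2 ^ L))%R.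

Section Cycles.

Variable L : nat.
Hypothesis L_gt0 : 0 < L.

(** The step for [g] is [2 ^ (g' - g)] times the step for [g'], so scaling a homomorphism by this
    factor lowers the index. *)
Lemma hom_cycles_gt0 F g g' : g <= g' -> g' <= L ->
  0 < hom F (cycles_digraph L g') -> 0 < hom F (cycles_digraph L g).
Proof.
move=> le_g le_g'L /(hom_translation_mulrn (2 ^ (g' - g))).
by rewrite -mulrnA -expnD; have -> : L - g' + (g' - g) = L - g by lia.
Qed.

Lemma order_cycles g (x : 'Z_(2 ^ L)) : g <= L ->
  order (fun y => y + (2 ^ (L - g))%:R)%R x = 2 ^ g.
Proof.
move=> le_gL; set f := fun y => _.
have iterE n : iter n f x = (x + (2 ^ (L - g) * n)%:R)%R.
  elim: n => [|n IHn] /=; first by rewrite muln0 addr0.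
  by rewrite IHn /f -addrA -natrD mulnS addnC.
have f_inj : injective f by move=> y z /addIr.
(* ['Z_n] is the ring of integers modulo [n] only for [n > 1]; hence the assumption [0 < L]. *)
have exp_gt1 : 1 < 2 ^ L by rewrite -{1}(expn0 2) ltn_exp2l.
have iter_fix n : (iter n f x == x) = (2 ^ g %| n).
  rewrite iterE -[X in _ == X]addr0 (inj_eq (addrI x)) -val_eqE /= val_Zp_nat //.
  by rewrite -/(dvdn _ _) -{1}(subnK le_gL) expnD dvdn_pmul2l // expn_gt0.
(* The order is a return time, hence a positive multiple of [2 ^ g]; conversely the first [2 ^ g]
   iterates of [x] close up into a cycle, which bounds the order from above. *)
apply/eqP; rewrite eqn_leq; apply/andP; split; last first.
  by rewrite dvdn_leq ?order_gt0 // -iter_fix iter_order.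
have szE : (2 ^ g).-1.+1 = 2 ^ g by rewrite prednK // expn_gt0.
have -> : 2 ^ g = size (traject f x (2 ^ g)) by rewrite size_traject.
rewrite -szE; apply: order_le_cycle; last by rewrite trajectS mem_head.
rewrite trajectS /= rcons_path fpath_traject /= last_traject -iterS szE.
by rewrite iter_fix.
Qed.

Lemma shortest_dicycle_cycles g l : g <= L ->
  shortest_dicycle_length (cycles_digraph L g) l <-> l = 2 ^ g.
Proof.
move=> le_gL; pose f (y : 'Z_(2 ^ L)) := (y + (2 ^ (L - g))%:R)%R.
(* In the graph of an injective map every directed cycle is the orbit of each of its vertices. *)
have dicycleE m : has_dicycle (cycles_digraph L g) m <-> m = 2 ^ g.
  split=> [[m_gt0 [c [sz_c /andP[cyc_c uniq_c]]]] | ->].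
    case: c sz_c cyc_c uniq_c => [|a c] sz_c cyc_c uniq_c.
      by rewrite -sz_c in m_gt0.
    by rewrite -sz_c -(order_cycles a le_gL) (order_cycle cyc_c) ?mem_head.
  split; first by rewrite expn_gt0.
  exists (orbit f 0%R); rewrite size_orbit order_cycles //; split=> //.
  rewrite /ucycle orbit_uniq andbT; apply: cycle_orbit.
  by move=> y z /addIr.
split=> [[/dicycleE] // | ->].
by split=> [|l' /dicycleE ->]; first exact/dicycleE.
Qed.

Lemma girth_even_power_cycles g : g <= L ->
  girth_even_power_of_two (cycles_digraph L g) <-> ~~ odd g.
Proof.
move=> le_gL; split=> [/(_ (2 ^ g)) | even_g l].
  case; first exact/shortest_dicycle_cycles.
  by move=> j /eqP; rewrite eqn_exp2l // => /eqP ->; rewrite oddM.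
move/(shortest_dicycle_cycles _ le_gL) => ->; exists g./2.
by rewrite mul2n even_halfK.
Qed.

End Cycles.

Lemma state_eq_of_answer (G : seq nat -> node) A i n :
  is_answer (G (state G A i)) -> i <= n -> state G A n = state G A i.
Proof.
move=> ans_i /subnKC <-; elim: (n - i) => [|m IHm]; first by rewrite addn0.
by rewrite addnS /state iterS -/(state G A _) IHm /next_state; case: ans_i => ->.
Qed.

Lemma size_state (G : seq nat -> node) A i :
  (forall j, j < i -> ~ is_answer (G (state G A j))) -> size (state G A i) = i.
Proof.
elim: i => [|i IHi] // nans; rewrite /state iterS -/(state G A i) /next_state.
have := nans i (leqnn _); case: (G _) => [F _ | [] | []]; [|by left|by right].
by rewrite size_rcons IHi // => j lt_ji; apply/nans/ltnW.
Qed.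

Lemma computation_path_of_answer (G : left_query_algorithm) A i :
  is_answer (G (state G A i)) -> computation_path G A (state G A i).
Proof. by move=> ans_i; exists i => n; exact: state_eq_of_answer. Qed.

(** Until an answer is reached each step adds one entry, so the first answered state has size equal
    to its index. It is the computation path, so this index is at most [k]. *)
Lemma k_query_answer k (G : left_query_algorithm) A :
  k_query k G -> is_answer (G (state G A k)).
Proof.
move=> kG; pose answered s := if G s is Query _ then false else true.
have answeredP s : reflect (is_answer (G s)) (answered s).
  by rewrite /answered; case: (G s) => [F | |]; constructor; [case | left | right].
have halts : exists n, answered (state G A n).
  by have [n /answeredP] := alg_halts G A; exists n.
have [n /answeredP ans_n min_n] := ex_minnP halts.
suff le_nk : n <= k by rewrite (state_eq_of_answer ans_n le_nk).
have <- : size (state G A n) = n.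
  apply: size_state => j lt_jn /answeredP /min_n.
  by rewrite leqNgt lt_jn.
exact/kG/computation_path_of_answer.
Qed.

Lemma computation_path_uniq (G : left_query_algorithm) A s t :
  computation_path G A s -> computation_path G A t -> s = t.
Proof.
move=> [m Hm] [n Hn].
by rewrite -(Hm (maxn m n)) ?leq_maxl // Hn ?leq_maxr.
Qed.

Lemma decides_state (G : left_query_algorithm) (C : digraph -> Prop) k A :
  k_query k G -> decides G C -> C A <-> G (state G A k) = YES.
Proof.
move=> kG dG; have pathk := computation_path_of_answer (k_query_answer A kG).
split=> [/dG[s [/computation_path_uniq /(_ pathk) ->]] // | Yk].
by apply/dG; exists (state G A k).
Qed.

(** This is the invariant of the binary search: a closed window of indices not separated in [i]
    steps. The induction keeps [m] general because each query halves the window. Both endpoints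
    belong to it, so two indices remain for [m = 0]. *)
Lemma cycles_same_state (G : seq nat -> node) L m i : 2 ^ (m + i) <= L ->
  exists lo s, lo + 2 ^ m <= L /\
    forall g, lo <= g <= lo + 2 ^ m -> state G (cycles_digraph L g) i = s.
Proof.
elim: i m => [|i IHi] m; first by rewrite addn0; exists 0, [::].
rewrite addnS -addSn => /IHi [lo [s [le_L same]]].
rewrite expnS in le_L same; pose mid := lo + 2 ^ m.
have stateS g : lo <= g <= lo + 2 * 2 ^ m ->
    state G (cycles_digraph L g) i.+1 = next_state G (cycles_digraph L g) s.
  by move=> Hg; rewrite /state iterS -/(state G _ i) same.
case Gs: (G s) => [F | |]; last 2 first.
(* An answered state no longer changes, so either half would do; the lower one is kept. *)
- exists lo, s; split=> [|g Hg]; first lia.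
  by rewrite stateS /next_state ?Gs //; lia.
- exists lo, s; split=> [|g Hg]; first lia.
  by rewrite stateS /next_state ?Gs //; lia.
have [hom_mid | hom_mid] := posnP (hom F (cycles_digraph L mid)).
  (* No homomorphism at [mid] means none at any larger index: the upper half answers 0
     throughout. *)
  exists mid, (rcons s 0); rewrite /mid; split=> [|g Hg]; first lia.
  rewrite stateS /next_state ?Gs; last lia.
  congr (rcons _ _); apply/eqP; rewrite -leqn0 leqNgt; apply/negP => hom_g.
  suff : 0 < hom F (cycles_digraph L mid) by rewrite hom_mid.
  by apply: hom_cycles_gt0 hom_g; rewrite /mid; lia.
(* A homomorphism at [mid] yields one at every smaller index, so the lower half always returns the
   count for translation by 0. *)
exists lo, (rcons s (hom F (translation_digraph (0 : 'Z_(2 ^ L))%R))).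
split=> [|g Hg]; first lia.
rewrite stateS /next_state ?Gs; last lia.
congr (rcons _ _); apply: hom_translation.
by apply: hom_cycles_gt0 hom_mid; rewrite /mid; lia.
Qed.

Theorem theorem15 (k : nat) :
  ~ exists G : left_query_algorithm,
      k_query k G /\ decides G girth_even_power_of_two.
Proof.
case=> G [kG dG].
have L_gt0 : 0 < 2 ^ k by rewrite expn_gt0.
(* The indices [g] and [g + 1] share the state [s] after [k] steps, although exactly one of them is
   even. *)
have [g [s [le_gL same]]] := @cycles_same_state G (2 ^ k) 0 k (leqnn _).
have memC h : g <= h <= g + 1 -> ~~ odd h <-> G s = YES.
  move=> Hh; rewrite -(same h Hh) -(decides_state _ kG dG).
  by rewrite girth_even_power_cycles //; lia.
have Hg : g <= g <= g + 1 by lia.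
have Hg1 : g <= g.+1 <= g + 1 by lia.
have := iff_trans (memC _ Hg) (iff_sym (memC _ Hg1)).
by rewrite /=; case: (odd g) => -[H1 H2]; [have := H2 isT | have := H1 isT].
Qed.
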